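(* For every integer $Q\ge 1$ there exists an interval $I\subset\left[-\tfrac12,\tfrac12\right]$ of length $|I|=\tfrac12\,Q^{-1}$ which does not contain any algebraic integer $\alpha$ of height $H(\alpha)\le Q$ and of any degree $n\ge 2$.
   Context: For a polynomial $P(t)=a_nt^n+\ldots+a_1t+a_0$ with integer coefficients, its height is $H(P)=\max_{0\le j\le n}|a_j|$. An algebraic integer $\alpha$ of degree $n$ is a root of a monic polynomial $P(t)=t^n+a_{n-1}t^{n-1}+\ldots+a_1t+a_0$ with integer coefficients that is irreducible over $\mathbb{Q}$; its height is $H(\alpha)=H(P)$ (the leading coefficient $1$ is included in the maximum). $|I|$ denotes the length of a real interval $I$. *)

(* Defs.v *)
From HB Require Import structures.
From mathcomp Require Import all_boot all_order all_algebra.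
Set Implicit Arguments.
Unset Strict Implicit.
Unset Printing Implicit Defensive.
Import Order.TTheory GRing.Theory Num.Theory.
Local Open Scope ring_scope.

Definition height (P : {poly int}) : nat := \max_(i < size P) `|(P`_i)%R|%N.

(* Irreducibility is over the rationals; in [{poly int}], [irreducible_poly]
   would use pseudo-division instead. *)
Definition integral_minpoly (K : numFieldType) (P : {poly int}) (alpha : K) :
    Prop :=
  [/\ P \is monic,
      irreducible_poly (map_poly intr P : {poly rat}) &
      root (map_poly intr P) alpha].

(* The polynomial P is unique when it exists, so the degree and the height of
   alpha are well defined; they are presented as one relation. Note that
   [size P] is the degree plus one. *)
Definition algebraic_integer (K : numFieldType) (n h : nat) (alpha : K) :
    Prop :=
  exists P : {poly int},
    [/\ integral_minpoly P alpha, size P = n.+1 & height P = h].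

(* Main.v *)
Require Import Defs.
From HB Require Import structures.
From mathcomp Require Import all_boot all_order all_algebra.
From mathcomp Require Import reals.
From mathcomp Require Import lra.
Set Implicit Arguments.
Unset Strict Implicit.
Unset Printing Implicit Defensive.
Import Order.TTheory GRing.Theory Num.Theory.
Local Open Scope ring_scope.

(** The interval is centred at the origin: [-1/(4Q), 1/(4Q)].  An irreducible
    integer polynomial P of degree at least 2 is not divisible by 'X, so its
    constant coefficient is a nonzero integer, of absolute value at least 1.
    If x is a root of P with |x| < 1, then a_0 = - (a_1 x + a_2 x^2 + ...), and
    when the coefficients are bounded by Q the geometric series gives
    1 <= |a_0| <= Q |x| / (1 - |x|), that is |x| >= 1 / (Q + 1).  This is
    Cauchy's lower bound on the modulus of the roots ([cauchy_root_bound]),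
    and 1/(4Q) < 1/(Q + 1), so no such root lies in the interval. *)

(** The geometric series bound M / (1 - |x|) for a polynomial with
    coefficients at most M.  With the denominator cleared, each Horner step
    replaces (1 - |x|) |q(x)| <= M by the convex combination
    |x| M + (1 - |x|) M = M. *)
Lemma horner_geometric_bound (R : numDomainType) (p : {poly R}) (M x : R) :
  `|x| <= 1 -> (forall i, `|p`_i| <= M) -> (1 - `|x|) * `|p.[x]| <= M.
Proof.
move=> x_le1; elim/poly_ind: p => [|q c IHq] boundM.
  by rewrite horner0 normr0 mulr0; move: (boundM 0); rewrite coef0 normr0.
have boundq i : `|q`_i| <= M.
  by have := boundM i.+1; rewrite -cons_poly_def coef_cons.
have boundc : `|c| <= M.
  by have := boundM 0; rewrite -cons_poly_def coef_cons.
have y_ge0 : 0 <= 1 - `|x| by rewrite subr_ge0.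
rewrite hornerMXaddC.
apply: le_trans (ler_wpM2l y_ge0 (ler_normD _ _)) _.
rewrite [leRHS](_ : M = `|x| * M + (1 - `|x|) * M); last first.
  by rewrite -mulrDl subrKC mul1r.
rewrite mulrDr; apply: lerD; last exact: ler_wpM2l.
by rewrite normrM mulrA mulrC ler_wpM2l // IHq.
Qed.

(** Dividing p - p(0) by 'X turns p(x) = 0 into |p(0)| = |x| |q(x)|, where the
    coefficients of q are again coefficients of p. *)
Lemma cauchy_root_bound (R : numDomainType) (p : {poly R}) (M x : R) :
  `|x| <= 1 -> (forall i, `|p`_i| <= M) -> root p x ->
  (1 - `|x|) * `|p`_0| <= `|x| * M.
Proof.
move=> x_le1; elim/poly_ind: p => [|q c _] boundM.
  by rewrite coef0 normr0 mulr0 mulr_ge0 // -(normr0 R) -(coef0 R 0).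
rewrite rootE hornerMXaddC addrC addr_eq0 => /eqP cE.
rewrite -cons_poly_def coef_cons /= cE normrN normrM mulrA mulrC.
apply: ler_wpM2l => //; apply: horner_geometric_bound => // i.
by have := boundM i.+1; rewrite -cons_poly_def coef_cons.
Qed.

Lemma irreducible_coef0_neq0 (F : fieldType) (p : {poly F}) :
  irreducible_poly p -> (2 < size p)%N -> p`_0 != 0.
Proof.
move=> [_ irr_p] size_p; apply/negP; rewrite -horner_coef0 => p0.
have /irr_p : size ('X - 0%:P : {poly F}) != 1 by rewrite size_XsubC.
rewrite dvdp_XsubCl => /(_ p0)/eqp_size.
by rewrite size_XsubC => sizeE; rewrite -sizeE in size_p.
Qed.

Lemma leq_height (P : {poly int}) i : (`|(P`_i)%R| <= height P)%N.
Proof.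
have [lt_iP | le_Pi] := ltnP i (size P); last by rewrite nth_default.
exact: (leq_bigmax (Ordinal lt_iP)).
Qed.

Lemma root_bound_height (R : numFieldType) (P : {poly int}) (x : R) :
  P`_0 != 0 -> `|x| <= 1 -> root (map_poly intr P) x ->
  1 - `|x| <= `|x| * (height P)%:R.
Proof.
move=> P0 x_le1 rootx.
have normE i : `|(map_poly intr P : {poly R})`_i| = `|(P`_i)%R|%N%:R.
  by rewrite coef_map /= natr_absz intr_norm.
apply: le_trans (cauchy_root_bound x_le1 _ rootx) => [|i]; last first.
  by rewrite normE ler_nat leq_height.
by rewrite normE ler_peMr ?subr_ge0 // ler1n absz_gt0.
Qed.

Theorem theorem1p1 (R : realType) (Q : nat) (hQ : (1 <= Q)%N) :
  exists a b : R,
    [/\ {subset `[a, b] <= `[- (1 / 2), 1 / 2]},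
        b - a = 1 / 2 * Q%:R^-1 &
        forall alpha : R, alpha \in `[a, b] ->
          ~ exists n h : nat,
              [/\ (2 <= n)%N, (h <= Q)%N & algebraic_integer n h alpha]].
Proof.
have Q_ge1 : 1 <= Q%:R :> R by rewrite ler1n.
have Qinv_le1 : Q%:R^-1 <= 1 :> R by rewrite invf_le1 // (lt_le_trans ltr01).
pose r : R := 1 / 4 * Q%:R^-1.
have r_le : r <= 1 / 4 by rewrite /r; lra.
have rQ : r * Q%:R = 1 / 4.
  by rewrite /r mulfVK // gt_eqF // (lt_le_trans ltr01).
exists (- r), r; split.
- by move=> x; rewrite !in_itv /= => /andP[? ?]; apply/andP; split; lra.
- by rewrite /r; lra.
move=> x; rewrite in_itv /= -ler_norml => x_le [n [h [n_ge2 h_le]]].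
move=> [P [[_ irrP rootP] sizeP heightP]].
have P0 : P`_0 != 0.
  have := irreducible_coef0_neq0 irrP.
  rewrite size_map_inj_poly ?sizeP //; last exact: intr_inj.
  by rewrite coef_map intr_eq0; apply.
have x_le1 : `|x| <= 1 by lra.
have := root_bound_height P0 x_le1 rootP; rewrite heightP.
(* The lower bound gives 3/4 <= 1 - |x| <= h |x|, while h |x| <= Q r = 1/4. *)
have : `|x| * h%:R <= r * Q%:R by rewrite ler_pM ?ler_nat.
lra.
Qed.
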